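(* Let $r,n,m,k$ be positive integers with $\mathrm{RInc}_k((n,m)/(r))\neq\emptyset$. Then $$\sum_{T\in \mathrm{RInc}_k((n,m)/(r))}q^{\mathrm{maj}(T)}=q^{\frac{k(k-1)}{2}}\left[{n+m-r-k\atop k}\right]\left(\left[{n+m-r-2k\atop n-r-k}\right]-\left[{n+m-r-2k\atop n-k+1}\right]\right)$$ and $$\sum_{T\in \mathrm{RInc}_k((n,m)/(r))}q^{\mathrm{amaj}(T)}=q^{\frac{k(k-1)}{2}}\left[{n+m-r-k\atop k}\right]\left(\left[{n+m-r-2k\atop n-r-k}\right]-q^{r+1}\left[{n+m-r-2k\atop n-k+1}\right]\right).$$
   Context: Tableaux are drawn in English notation (row 1 on top). A row-increasing tableau of skew shape $\lambda/\mu$ (with $\lambda\supseteq\mu$ partitions) is a filling of the boxes of $\lambda/\mu$ by positive integers that is strictly increasing along rows (left to right) and weakly increasing down columns, and whose set of entries is an initial segment $\{1,2,\dots,N\}$ of the positive integers. $\mathrm{RInc}_k(\lambda/\mu)$ is the set of row-increasing tableaux of shape $\lambda/\mu$ with maximal entry $|\lambda/\mu|-k$. Here $\lambda=(n,m)$ (so $n\ge m$) and $\mu=(r)$ (so $r\le n$), and $|\lambda/\mu|=n+m-r$. A descent of a tableau $T$ is an integer $i$ such that some occurrence of $i$ in $T$ lies in a row strictly above the row of some occurrence of $i+1$; $\mathrm{maj}(T)$ is the sum of all descents of $T$ (each counted once). An ascent of $T$ is an integer $i$ such that some occurrence of $i$ in $T$ lies in a row strictly below the row of some occurrence of $i+1$;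 $\mathrm{amaj}(T)$ is the sum of all ascents of $T$ (each counted once). $\left[{a\atop b}\right]$ denotes the $q$-binomial coefficient $\frac{[a]!}{[b]!\,[a-b]!}$, where $[a]=\frac{1-q^a}{1-q}$ and $[a]!=[1][2]\cdots[a]$; it is $0$ if $b<0$ or $b>a$. *)

(* Defs.v *)
From mathcomp Require Import all_boot all_order all_algebra.

Set Implicit Arguments.
Unset Strict Implicit.
Unset Printing Implicit Defensive.

Import GRing.Theory Num.Theory.

Section SkewTableaux.

(* Partitions are sequences of parts, largest first; boxes are pairs
   (row, column), both counted from 0, with row 0 on top. *)
Variables la mu : seq nat.

Definition box : finType :=
  {x : 'I_(size la) * 'I_(head 0 la)
     | nth 0 mu x.1 <= x.2 < nth 0 la x.1}.

Definition row_of (b : box) : nat := (val b).1.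
Definition col_of (b : box) : nat := (val b).2.

(* The entries of a row-increasing tableau form an initial segment of the
   positive integers, so none of them exceeds the number of boxes: bounding the
   entries of a filling this way loses no tableau and makes fillings a finite
   type. *)
Definition filling : finType := {ffun box -> 'I_(#|box|).+1}.

Implicit Type T : filling.

Definition row_increasing T : bool :=
  [forall x, forall y,
    (row_of x == row_of y) && (col_of x < col_of y) ==> (T x < T y)].

Definition col_weakly_increasing T : bool :=
  [forall x, forall y,
    (col_of x == col_of y) && (row_of x < row_of y) ==> (T x <= T y)].

Definition entries_initial_segment T : bool :=
  [exists N : 'I_(#|box|).+1, forall v : 'I_(#|box|).+1,
    [exists x, T x == v] == (0 < v <= N)].

Definition is_row_increasing_tableau T : bool :=
  [&& row_increasing T, col_weakly_increasing T & entries_initial_segment T].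

Definition max_entry T : nat := \max_x T x.

(* [max_entry T + k == #|box|] avoids truncated subtraction. *)
Definition RInc (k : nat) : {set filling} :=
  [set T | is_row_increasing_tableau T & max_entry T + k == #|box|].

Definition is_descent T (i : nat) : bool :=
  [exists x, exists y,
    [&& (T x == i :> nat), (T y == i.+1 :> nat) & (row_of x < row_of y)]].

Definition is_ascent T (i : nat) : bool :=
  [exists x, exists y,
    [&& (T x == i :> nat), (T y == i.+1 :> nat) & (row_of y < row_of x)]].

(* Descents and ascents are entries of T, hence at most #|box|. *)
Definition maj T : nat := \sum_(0 <= i < (#|box|).+1 | is_descent T i) i.
Definition amaj T : nat := \sum_(0 <= i < (#|box|).+1 | is_ascent T i) i.

End SkewTableaux.

Section QAnalogues.

Local Open Scope ring_scope.

Variables (F : fieldType) (q : F).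

Definition qint (a : nat) : F := (1 - q ^+ a) / (1 - q).

Definition qfact (a : nat) : F := \prod_(1 <= i < a.+1) qint i.

Definition qbinom (a b : int) : F :=
  if (0 <= b) && (b <= a)
  then qfact `|a|%N / (qfact `|b|%N * qfact `|a - b|%N)
  else 0.

End QAnalogues.

(* The indeterminate q, as an element of the field Q(q). *)
Definition qvar : {fraction {poly rat}} := tofrac ('X : {poly rat})%R.

(* Main.v *)
(** Record a two-row tableau as the word whose [v]-th letter says whether [v]
    lies in the first row only (Up), in the second row only (Down), or in both.
    Column weakness becomes the ballot condition #Down <= #Up + r on prefixes,
    in which the letters Both play no role; the major index becomes that of the
    word, where Both behaves as a Down after, and as an Up before, any letter.

    Let A(h,l,k) enumerate by major index the ballot words with [h] Ups, [l]
    Downs and [k] Boths, and let Q(h,l,k) do the same after adding the descent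
    created by appending a Down.  Removing the last letter gives, with N = h+l+k,
      A(h,l,k) = A(h-1,l,k) + Q(h,l-1,k) + Q(h,l,k-1),
      Q(h,l,k) = q^N A(h-1,l,k) + Q(h,l-1,k) + q^N Q(h,l,k-1),
    and the two q-Pascal rules give A(h,l,k) = q^C(k,2) [N,k] A(h,l,0) and
    Q(h,l,k) = q^(C(k,2)+k) [N,k] Q(h,l,0).  The values at [k = 0] are reflection
    formulas: they satisfy the same recurrences and cancel, by the symmetry of
    the q-binomials, just outside the ballot region.  Ascents are descents of
    the word with Up and Down exchanged, now subject to #Up <= #Down + r. *)
Require Import Defs.
From mathcomp Require Import all_boot all_order all_algebra.
From mathcomp Require Import zify ring.

Set Implicit Arguments.
Unset Strict Implicit.
Unset Printing Implicit Defensive.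

Import GRing.Theory.

(** * Gaussian binomials *)

Section GaussianBinomials.
Local Open Scope ring_scope.

Variables (R : comNzRingType) (q : R).

Fixpoint gauss (n k : nat) : R :=
  match n, k with
  | _, 0 => 1
  | 0, _.+1 => 0
  | n'.+1, k'.+1 => gauss n' k' + q ^+ k * gauss n' k
  end.

Arguments gauss : simpl never.

Lemma gauss0 n : gauss n 0 = 1.
Proof. by case: n. Qed.

Lemma gaussSS n k :
  gauss n.+1 k.+1 = gauss n k + q ^+ k.+1 * gauss n k.+1.
Proof. by []. Qed.

Lemma gauss_small n k : (n < k)%N -> gauss n k = 0.
Proof.
elim: n k => [|n IHn] [|k] // lt_nk.
by rewrite gaussSS !IHn ?mulr0 ?addr0 // ltnW.
Qed.

Lemma gaussnn n : gauss n n = 1.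
Proof. by elim: n => // n IHn; rewrite gaussSS IHn gauss_small ?mulr0 ?addr0. Qed.

(** The second q-Pascal rule. By induction, applying it to both terms of the first rule yields the
    same four summands as applying the first rule to both terms of the second. *)
Lemma gaussSS_sub n k : (k <= n)%N ->
  gauss n.+1 k.+1 = q ^+ (n - k) * gauss n k + gauss n k.+1.
Proof.
elim: n k => [|n IHn] [|k] //.
- by rewrite gaussSS gauss0 gauss_small // => _; ring.
- have:= IHn 0 isT; rewrite !subn0 !gauss0 mulr1 => E _.
  by rewrite gaussSS {1}E gaussSS -[0.+1]/1%N !gauss0 (exprS q n); ring.
rewrite ltnS subSS leq_eqVlt => /predU1P[->|lt_kn].
  by rewrite subnn !gaussnn gauss_small //; ring.
rewrite [LHS]gaussSS {1}(IHn k (ltnW lt_kn)) {1}(IHn k.+1) // !gaussSS.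
by rewrite -(subnSK lt_kn) !exprS; ring.
Qed.

(* Both sides vanish when [k > n], so no bound on [k] is needed once
   [q ^+ (n - k)] is written as a quotient [q ^+ i / q ^+ j]. *)
Lemma gaussSS_top i j n k : (i + k = j + n)%N ->
  q ^+ j * gauss n.+1 k.+1 = q ^+ i * gauss n k + q ^+ j * gauss n k.+1.
Proof.
move=> E; have [le_kn|lt_nk] := leqP k n.
  rewrite gaussSS_sub // (_ : i = j + (n - k))%N; last by lia.
  by rewrite exprD; ring.
by rewrite !gauss_small ?mulr0 ?addr0 //; lia.
Qed.

(** Double induction, expanding one side by the first q-Pascal rule and the other by the second. *)
Lemma gauss_sym i j : gauss (i + j) i = gauss (i + j) j.
Proof.
elim: i j => [|i IHi] j; first by rewrite add0n gaussnn gauss0.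
elim: j => [|j IHj]; first by rewrite addn0 gaussnn gauss0.
rewrite addSn gaussSS IHi addnS -addSn IHj.
rewrite -[RHS]mul1r -(expr0 q) (@gaussSS_top i.+1 0%N) //.
by rewrite expr0 mul1r addrC.
Qed.

End GaussianBinomials.

Arguments gauss : simpl never.

(** * Gaussian binomials as quotients of q-factorials *)

Section GaussianFactorials.
Local Open Scope ring_scope.

Variables (F : fieldType) (q : F).
Hypothesis q_not_root : forall a, q ^+ a.+1 != 1.

Lemma qfactS n : qfact q n.+1 = qfact q n * qint q n.+1.
Proof. by rewrite /qfact big_nat_recr. Qed.

Lemma qfact0 : qfact q 0 = 1.
Proof. by rewrite /qfact big_nil. Qed.

Let q1_neq0 : 1 - q != 0.
Proof. by rewrite subr_eq0 eq_sym -[q]expr1. Qed.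

Lemma qfact_neq0 n : qfact q n != 0.
Proof.
elim: n => [|n IHn]; first by rewrite qfact0 oner_eq0.
by rewrite qfactS mulf_neq0 // mulf_neq0 ?invr_eq0 // subr_eq0 eq_sym.
Qed.

(** Double induction: once the factorials are collected, the first q-Pascal rule amounts to [i+j+2]
    = [i+1] + q^(i+1) [j+1]. *)
Lemma gauss_qfact i j :
  gauss q (i + j) i * (qfact q i * qfact q j) = qfact q (i + j).
Proof.
elim: i j => [|i IHi] j; first by rewrite gauss0 qfact0 !mul1r.
elim: j => [|j IHj]; first by rewrite addn0 gaussnn qfact0 mul1r mulr1.
have Ei := IHi j.+1; have -> : (i.+1 + j.+1 = (i + j.+1).+1)%N by [].
rewrite addnS -addSn in Ei *.
rewrite gaussSS (qfactS (i.+1 + j)).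
transitivity (qfact q (i.+1 + j) * (qint q i.+1 + q ^+ i.+1 * qint q j.+1)).
  rewrite [RHS]mulrDr -{1}Ei -IHj !qfactS; ring.
congr (_ * _); rewrite /qint mulrA -mulrDl; congr (_ / _).
by rewrite addSn -addnS -addSn exprD; ring.
Qed.

Lemma qbinom_gauss (n k : nat) : qbinom q n%:Z k%:Z = gauss q n k.
Proof.
rewrite /qbinom lez_nat /=; case: leqP => [le_kn|lt_nk]; last first.
  by rewrite gauss_small.
rewrite -(subnKC le_kn) -gauss_qfact PoszD addrAC subrr add0r !absz_nat.
by rewrite mulfK // mulf_neq0 ?qfact_neq0.
Qed.

End GaussianFactorials.

(** * Enumeration of ballot words by major index *)

Notation letter := (option bool).
Notation Up := (Some true).
Notation Down := (Some false).
Notation Both := None.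

Definition has_up (x : letter) := x != Down.
Definition has_down (x : letter) := x != Up.

Fixpoint words (N : nat) : seq (seq letter) :=
  if N is N'.+1 then [seq x :: w | x <- [:: Up; Down; Both], w <- words N']
  else [:: [::]].

(* Words are stored with the last letter at the head, so that the descent
   between the two outermost letters of [x :: w] sits at position [size w]. *)
Definition top_weight (w : seq letter) : nat :=
  if has_up (head Down w) then size w else 0.

Fixpoint rmaj (w : seq letter) : nat :=
  if w is x :: w' then rmaj w' + (if has_down x then top_weight w' else 0)
  else 0.

Definition content (w : seq letter) : nat * nat * nat :=
  (count_mem Up w, count_mem Down w, count_mem Both w).

Fixpoint ballot (V : rel nat) (w : seq letter) : bool :=
  if w is _ :: w' then V (count_mem Up w) (count_mem Down w) && ballot V w'
  else true.

Lemma mem_words N w : (w \in words N) = (size w == N).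
Proof.
elim: N w => [|N IHN] w; first by rewrite inE; case: w.
apply/allpairsP/idP => [[[x v] /= [_ v_in ->]]|].
  by rewrite /= eqSS -IHN.
case: w => [|x w] //; rewrite /= eqSS => szw.
by exists (x, w); split; rewrite ?IHN //; case: x => [[]|].
Qed.

Lemma uniq_words N : uniq (words N).
Proof.
elim: N => // N IHN; apply: allpairs_uniq => //.
by move=> [x v] [y w] _ _ /= [-> ->].
Qed.

Section WordEnumerator.
Local Open Scope ring_scope.

Variables (R : comNzRingType) (q : R) (V : rel nat).

(** The weight [f] is arbitrary because removing the last letter turns one weight into another,
    linking the two enumerators [A] and [Q] below. *)
Definition enum_words (f : seq letter -> R) (N h l k : nat) : R :=
  \sum_(w <- words N | ballot V w && (content w == (h, l, k))) f w.

Lemma enum_wordsS f N h l k :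
  enum_words f N.+1 h l k =
  if V h l then
    (if h is h'.+1 then enum_words (fun w => f (Up :: w)) N h' l k else 0)
    + (if l is l'.+1 then enum_words (fun w => f (Down :: w)) N h l' k else 0)
    + (if k is k'.+1 then enum_words (fun w => f (Both :: w)) N h l k' else 0)
  else 0.
Proof.
rewrite /enum_words /= !big_cat !big_map big_nil /= addr0 addrA.
have E x :
    \sum_(j <- words N | ballot V (x :: j) && (content (x :: j) == (h, l, k)))
      f (x :: j) =
    if V h l then
      \sum_(j <- words N | ballot V j && (content (x :: j) == (h, l, k)))
        f (x :: j)
    else 0.
  case: ifP => HV; last first.
    rewrite big1 // => w /andP[/= /andP[H _]] /eqP[E1 E2 _].
    by rewrite E1 E2 HV in H.
  apply: eq_bigl => w.
  case: (content (x :: w) =P (h, l, k)) => [[E1 E2 _]|_]; last by rewrite !andbF.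
  by move: E1 E2; rewrite /= => -> ->; rewrite HV !andbT.
rewrite (E Up) (E Down) (E Both); case: ifP => _; last by rewrite !addr0.
rewrite /content; congr (_ + _ + _).
- by case: h {E} => [|h];
  [rewrite big_pred0 //|apply: eq_bigl] => w; rewrite !xpair_eqE /= ?andbF.
- by case: l {E} => [|l];
  [rewrite big_pred0 //|apply: eq_bigl] => w; rewrite !xpair_eqE /= ?andbF.
- by case: k {E} => [|k];
  [rewrite big_pred0 //|apply: eq_bigl] => w; rewrite !xpair_eqE /= ?andbF.
Qed.

End WordEnumerator.

(** * Factoring out the letters [Both] *)

Section RecursiveEnumeration.
Local Open Scope ring_scope.

Variables (R : comNzRingType) (q : R) (V : rel nat) (alpha beta : nat -> nat -> R).

Let from_up h l : R :=
  if h is h'.+1 then (if V h' l then alpha h' l else 0) else 0.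
Let from_down h l : R :=
  if l is l'.+1 then (if V h l' then beta h l' else 0) else 0.

Hypothesis V00 : V 0 0.
Hypothesis alpha00 : alpha 0 0 = 1.
Hypothesis beta00 : beta 0 0 = 1.
Hypothesis alphaE : forall h l,
  V h l -> (0 < h + l)%N -> alpha h l = from_up h l + from_down h l.
Hypothesis betaE : forall h l, V h l -> (0 < h + l)%N ->
  beta h l = q ^+ (h + l) * from_up h l + from_down h l.

Let A := enum_words V (fun w => q ^+ rmaj w).
Let Q := enum_words V (fun w => q ^+ (rmaj w + top_weight w)).

Let AS N h l k : A N.+1 h l k =
  if V h l then (if h is h'.+1 then A N h' l k else 0)
    + (if l is l'.+1 then Q N h l' k else 0)
    + (if k is k'.+1 then Q N h l k' else 0)
  else 0.
Proof.
rewrite /A enum_wordsS; case: ifP => // _; congr (_ + _ + _).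
by case: h => // h; apply: eq_bigr => w _; rewrite /= addn0.
Qed.

Let QS N h l k : Q N.+1 h l k =
  if V h l then (if h is h'.+1 then q ^+ N.+1 * A N h' l k else 0)
    + (if l is l'.+1 then Q N h l' k else 0)
    + (if k is k'.+1 then q ^+ N.+1 * Q N h l k' else 0)
  else 0.
Proof.
rewrite /Q enum_wordsS; case: ifP => // _; congr (_ + _ + _).
- case: h => // h; rewrite /enum_words mulr_sumr big_seq_cond [RHS]big_seq_cond.
  apply: eq_bigr => w /andP[]; rewrite mem_words => /eqP <- _.
  by rewrite /= addn0 /top_weight /= -exprD addnC.
- case: l => // l; apply: eq_bigr => w _.
  by rewrite /= {2}/top_weight /= addn0.
case: k => // k; rewrite /enum_words mulr_sumr big_seq_cond [RHS]big_seq_cond.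
apply: eq_bigr => w /andP[]; rewrite mem_words => /eqP <- _.
by rewrite /= {2}/top_weight /= -exprD addnC.
Qed.

(** It suffices to solve the recurrences without [Both]: any [alpha], [beta] satisfying them on [V]
    determine the enumerators for all [k]. The induction removes the last letter. *)
Lemma enum_words_gauss N h l k : (h + l + k)%N = N ->
  A N h l k = (if V h l then q ^+ 'C(k, 2) * gauss q N k * alpha h l else 0) /\
  Q N h l k = (if V h l then q ^+ ('C(k, 2) + k) * gauss q N k * beta h l else 0).
Proof.
elim: N h l k => [|N IHN] h l k.
  case: h l k => [|//] [|//] [|//] _; rewrite V00 alpha00 beta00.
  rewrite /A /Q /enum_words /= !big_cons !big_nil /= /top_weight /=.
  by rewrite gauss0 !expr0 !mulr1 !addr0.
move=> EN; rewrite AS QS; case: ifP => // HV.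
have eA : (if h is h'.+1 then A N h' l k else 0) =
    q ^+ 'C(k, 2) * gauss q N k * from_up h l.
  case: h EN {HV} => [|h] EN; first by rewrite /from_up mulr0.
  by rewrite (proj1 (IHN h l k _)) /from_up; [case: ifP; rewrite ?mulr0|lia].
have eA' : (if h is h'.+1 then q ^+ N.+1 * A N h' l k else 0) =
    q ^+ N.+1 * (q ^+ 'C(k, 2) * gauss q N k * from_up h l).
  by rewrite -eA; case: (h) => //; rewrite mulr0.
have eQ : (if l is l'.+1 then Q N h l' k else 0) =
    q ^+ ('C(k, 2) + k) * gauss q N k * from_down h l.
  case: l EN {HV eA eA'} => [|l] EN; first by rewrite /from_down mulr0.
  by rewrite (proj2 (IHN h l k _)) /from_down; [case: ifP; rewrite ?mulr0|lia].
rewrite {}eA {}eA' {}eQ.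
case: k EN => [|k] EN.
  rewrite addn0 in EN.
  have hl_gt0 : (0 < h + l)%N by rewrite EN.
  by rewrite alphaE // betaE // EN !gauss0 !bin0n !expr0 !addr0; split; ring.
rewrite (proj2 (IHN h l k _)) ?HV; last by lia.
have -> : 'C(k.+1, 2) = ('C(k, 2) + k)%N by rewrite binS bin1.
(* Words consisting of [Both] only are separate, since [alphaE] and [betaE] say nothing at (0,
   0). *)
have [hl0|hl_gt0] := posnP (h + l)%N.
  have [h0 l0] : h = 0%N /\ l = 0%N by lia.
  have -> : N = k by lia.
  rewrite h0 l0 alpha00 beta00 !gaussnn gauss_small // /from_up /from_down.
  by rewrite !(exprD, exprS); split; ring.
have <- : (h + l + k)%N = N by lia.
have gauss_top := @gaussSS_top R q (h + l)%N 0 (h + l + k) k erefl.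
rewrite expr0 !mul1r in gauss_top.
(* Compare the coefficients of [from_up] and [from_down]. In [A] the former is the second q-Pascal
   rule and the latter the first; in [Q] both come from the second, as N + 1 = (h + l) + (k + 1). *)
split; rewrite ?alphaE ?betaE // [RHS]mulrDr.
  by rewrite -mulrA [in X in _ = X + _]gauss_top gaussSS !(exprD, exprS); ring.
by rewrite gauss_top !(exprD, exprS); ring.
Qed.

End RecursiveEnumeration.

(** * Reflection formulas for the two ballot conditions *)

Section BallotEnumeration.
Local Open Scope ring_scope.

Variables (R : comNzRingType) (q : R) (r : nat).

(** Each of [alpha] and [beta] is a difference of two terms obeying the same unrestricted
    recurrence. The first q-Pascal rule gives the recurrence for [alpha], the second that for
    [beta]. *)
Lemma enum_ballot_maj h l k : (l <= h + r)%N ->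
  enum_words (fun h l => l <= h + r)%N (fun w => q ^+ rmaj w) (h + l + k) h l k =
  q ^+ 'C(k, 2) * gauss q (h + l + k) k
  * (gauss q (h + l) h - gauss q (h + l) (h + r).+1).
Proof.
move=> Vhl.
pose alpha h l := gauss q (h + l) h - gauss q (h + l) (h + r).+1.
pose beta h l := q ^+ h * gauss q (h + l) h
  - q ^+ (h + r).+1 * gauss q (h + l) (h + r).+1.
have alpha0 h' l' : (h' + r < l' <= (h' + r).+1)%N -> alpha h' l' = 0.
  move=> Hl; rewrite /alpha (_ : l' = (h' + r).+1); last by lia.
  by rewrite gauss_sym subrr.
have [|||||E _] := @enum_words_gauss R q (fun h l => l <= h + r)%N alpha beta
  _ _ _ _ _ _ h l k erefl.
- by [].
- by rewrite /alpha gauss0 gauss_small ?subr0.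
- by rewrite /beta gauss0 gauss_small //; ring.
- move=> [|h'] [|l'] //= Hl _.
  + by rewrite add0r (ltnW Hl) /alpha /beta !gauss0 !gauss_small ?add0n //;
      (lia || ring).
  + by rewrite /alpha !addn0 !gaussnn !gauss_small ?addr0 //; lia.
  (* Removing an [Up] can leave the ballot region only onto the line l = h + r + 1, where [alpha]
     vanishes, so the guard may be dropped. Removing a [Down] never leaves the region. *)
  + have -> : (if (l' < h' + r)%N then alpha h' l'.+1 else 0) = alpha h' l'.+1.
      by case: ifP => // lt; rewrite alpha0 //; lia.
    rewrite (_ : (l' <= h'.+1 + r)%N); last by lia.
    by rewrite /alpha /beta !(addSn, addnS) !gaussSS; ring.
- move=> [|h'] [|l'] //= Hl _.
  + by rewrite (ltnW Hl) /alpha /beta !gauss0 !gauss_small ?add0n //;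
      (lia || ring).
  + by rewrite /alpha /beta !addn0 !gaussnn !gauss_small //; (lia || ring).
  + have -> : (if (l' < h' + r)%N then alpha h' l'.+1 else 0) = alpha h' l'.+1.
      by case: ifP => // lt; rewrite alpha0 //; lia.
    rewrite (_ : (l' <= h'.+1 + r)%N); last by lia.
    rewrite /alpha /beta !(addSn, addnS).
    (* The prefactors of the two terms of [beta] are such that the second rule produces the same
       power q^(h+l) in both. *)
    rewrite (@gaussSS_top R q (h' + l').+2 h'.+1 _ h'); last by lia.
    rewrite (@gaussSS_top R q (h' + l').+2 (h' + r).+2 _ (h' + r).+1); last by lia.
    by ring.
by move: E; rewrite Vhl.
Qed.

(** Now removing a [Down] is what can leave the region, so it is [beta] that must vanish on the
    boundary line h = l + r + 1. This puts the factor q^(r+1) into [alpha], and the two q-Pascal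
    rules exchange roles. *)
Lemma enum_ballot_amaj h l k : (h <= l + r)%N ->
  enum_words (fun h l => h <= l + r)%N (fun w => q ^+ rmaj w) (h + l + k) h l k =
  q ^+ 'C(k, 2) * gauss q (h + l + k) k
  * (gauss q (h + l) l - q ^+ r.+1 * gauss q (h + l) (l + r).+1).
Proof.
move=> Vhl.
pose alpha h l := gauss q (h + l) l - q ^+ r.+1 * gauss q (h + l) (l + r).+1.
pose beta h l := q ^+ h * (gauss q (h + l) l - gauss q (h + l) (l + r).+1).
have beta0 h' l' : (l' + r < h' <= (l' + r).+1)%N -> beta h' l' = 0.
  move=> Hl; rewrite /beta (_ : h' = (l' + r).+1); last by lia.
  by rewrite -gauss_sym subrr mulr0.
have [|||||E _] := @enum_words_gauss R q (fun h l => h <= l + r)%N alpha beta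
  _ _ _ _ _ _ h l k erefl.
- by [].
- by rewrite /alpha gauss0 gauss_small ?mulr0 ?subr0.
- by rewrite /beta gauss0 gauss_small //; ring.
- move=> [|h'] [|l'] //= Hl _.
  + by rewrite /alpha /beta !gaussnn !gauss_small ?add0n //;
      (lia || ring).
  + by rewrite (ltnW Hl) /alpha !gauss0 !gauss_small ?addr0 ?addn0 //; lia.
  + have -> : (if (h' < l' + r)%N then beta h'.+1 l' else 0) = beta h'.+1 l'.
      by case: ifP => // lt; rewrite beta0 //; lia.
    rewrite (_ : (h' <= l'.+1 + r)%N); last by lia.
    rewrite /alpha /beta !(addSn, addnS).
    have := @gaussSS_top R q h'.+1 0 (h' + l').+1 l'.
    rewrite expr0 !mul1r => ->; last by lia.
    (* The factor q^(r+1) raises the power given by the second rule to q^(h'+1), the one occurring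
       in the other term. *)
    rewrite (@gaussSS_top R q h'.+1 r.+1 _ (l' + r).+1); last by lia.
    by ring.
- move=> [|h'] [|l'] //= Hl _.
  + by rewrite /alpha /beta !gaussnn !gauss_small ?add0n //;
      (lia || ring).
  + by rewrite (ltnW Hl) /alpha /beta !gauss0 !gauss_small ?addn0 //; (lia || ring).
  + have -> : (if (h' < l' + r)%N then beta h'.+1 l' else 0) = beta h'.+1 l'.
      by case: ifP => // lt; rewrite beta0 //; lia.
    rewrite (_ : (h' <= l'.+1 + r)%N); last by lia.
    by rewrite /alpha /beta !(addSn, addnS) !gaussSS !(exprD, exprS); ring.
by move: E; rewrite Vhl.
Qed.

End BallotEnumeration.

(** * Words and pairs of rows *)

Fixpoint positions (p : pred letter) (w : seq letter) : seq nat :=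
  if w is x :: w' then
    if p x then rcons (positions p w') (size w) else positions p w'
  else [::].

(** A value outside [s] becomes [Down] without consulting [t]: in a [row_pair] it must lie in
    [t]. *)
Fixpoint encode (s t : seq nat) (N : nat) : seq letter :=
  if N is N'.+1 then
    (if N \in s then if N \in t then Both else Up else Down) :: encode s t N'
  else [::].

Definition row_pair (N : nat) (s t : seq nat) :=
  [/\ sorted ltn s, sorted ltn t
    & forall v, (v \in s) || (v \in t) = (0 < v <= N)].

(** The row [s] starts in column [r], whence the index [c - r]. Asking for it to be in range makes
    the condition fail when [t] sticks out too far, as the ballot condition does. *)
Definition columns_ok (r : nat) (s t : seq nat) := forall c,
  r <= c < size t -> (c - r < size s) && (nth 0 s (c - r) <= nth 0 t c).

Lemma row_pairC N s t : row_pair N s t -> row_pair N t s.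
Proof. by case=> ss st E; split=> // v; rewrite orbC. Qed.

Lemma size_encode s t N : size (encode s t N) = N.
Proof. by elim: N => //= N ->. Qed.

Lemma size_positions p w : size (positions p w) = count p w.
Proof. by elim: w => //= x w IHw; case: ifP; rewrite ?size_rcons IHw. Qed.

Lemma positions_bounds p w v : v \in positions p w -> 0 < v <= size w.
Proof.
elim: w => //= x w IHw; case: ifP => _; rewrite ?mem_rcons ?inE.
  by case/predU1P => [->|/IHw]; rewrite ?leqnn //; lia.
by move/IHw; lia.
Qed.

Lemma sorted_rcons_ltn s v :
  sorted ltn s -> (forall u, u \in s -> u < v) -> sorted ltn (rcons s v).
Proof.
case: s => //= u s su lt_v; rewrite rcons_path su /=.
by apply: lt_v; rewrite mem_last.
Qed.

Lemma sorted_positions p w : sorted ltn (positions p w).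
Proof.
elim: w => //= x w IHw; case: ifP => // _; apply: sorted_rcons_ltn => // u.
by move/positions_bounds; rewrite ltnS => /andP[].
Qed.

Lemma row_pair_positions w :
  row_pair (size w) (positions has_up w) (positions has_down w).
Proof.
split; [exact: sorted_positions..|elim: w => [|x w IHw] v /=; first by case: v].
have E : (0 < v <= (size w).+1) = (v == (size w).+1) || (0 < v <= size w) by lia.
rewrite E -IHw; case: x => [[]|]; rewrite /has_up /has_down /= ?mem_rcons ?inE.
- by rewrite orbA.
- by rewrite orbCA.
by rewrite orbACA orbb.
Qed.

Lemma positions_filter s t N (p : pred letter) (u : seq nat) :
  (forall v, 0 < v <= N ->
     p (if v \in s then if v \in t then Both else Up else Down) = (v \in u)) ->
  positions p (encode s t N) = [seq v <- iota 1 N | v \in u].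
Proof.
elim: N => // N IHN Hp; rewrite -{2}[N.+1]addn1 iotaD filter_cat /= size_encode.
rewrite Hp ?leqnn // add1n IHN => [|v Hv]; last by apply: Hp; lia.
by case: ifP => _; rewrite ?cats1 ?cats0.
Qed.

Lemma filter_iota_sorted N (s : seq nat) :
  sorted ltn s -> (forall v, v \in s -> 0 < v <= N) ->
  [seq v <- iota 1 N | v \in s] = s.
Proof.
move=> ss bs; apply: (irr_sorted_eq ltn_trans ltnn) => //.
  by rewrite sorted_filter ?iota_ltn_sorted //; exact: ltn_trans.
move=> v; rewrite mem_filter mem_iota; case: (boolP (v \in s)) => //= /bs.
by rewrite add1n ltnS.
Qed.

Lemma positions_encode N s t : row_pair N s t ->
  positions has_up (encode s t N) = s /\ positions has_down (encode s t N) = t.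
Proof.
case=> ss st E; rewrite (positions_filter (u := s)) ?(positions_filter (u := t)).
- by rewrite !filter_iota_sorted // => v Hv; rewrite -E Hv ?orbT.
- move=> v Hv; have := E v; rewrite Hv.
  by case: (v \in s); case: (v \in t).
by move=> v _; case: (v \in s); case: (v \in t).
Qed.

Lemma eq_encode N s t s' t' :
  (forall v, v <= N -> (v \in s) = (v \in s')) ->
  (forall v, v <= N -> (v \in t) = (v \in t')) -> encode s t N = encode s' t' N.
Proof.
elim: N => //= N IHN Es Et; rewrite Es // Et // IHN // => v Hv.
  exact/Es/leqW.
exact/Et/leqW.
Qed.

Lemma encode_positions w :
  encode (positions has_up w) (positions has_down w) (size w) = w.
Proof.
elim: w => //= x w IHw.
have N_in p : ((size w).+1 \in positions p w) = false.
  by apply/negP => /positions_bounds; rewrite ltnn andbF.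
congr (_ :: _).
  by case: x => [[]|]; rewrite /has_up /has_down /= ?mem_rcons ?inE ?eqxx ?N_in.
by rewrite -[RHS]IHw; apply: eq_encode => v Hv; case: ifP; rewrite ?mem_rcons ?inE //;
  rewrite (ltn_eqF (Hv : v < _.+1)).
Qed.

(** The new entry [v] exceeds all others, so below any existing upper neighbour it is admissible;
    only the existence of that neighbour, a comparison of lengths, has to be checked. *)
Lemma columns_ok_rcons r (s t : seq nat) v (bs bt : bool) :
  (forall u, u \in s -> u < v) -> (forall u, u \in t -> u < v) ->
  let s' := if bs then rcons s v else s in
  let t' := if bt then rcons t v else t in
  columns_ok r s' t' <-> (size t' <= size s' + r) /\ columns_ok r s t.
Proof.
move=> sv tv s' t'.
have sz_s' : size s' = size s + bs by rewrite /s'; case: (bs); rewrite ?size_rcons; lia.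
have sz_t' : size t' = size t + bt by rewrite /t'; case: (bt); rewrite ?size_rcons; lia.
have nth_s' i : i < size s -> nth 0 s' i = nth 0 s i.
  by rewrite /s'; case: (bs) => // Hi; rewrite nth_rcons Hi.
have nth_t' i : i < size t -> nth 0 t' i = nth 0 t i.
  by rewrite /t'; case: (bt) => // Hi; rewrite nth_rcons Hi.
have last_t' : bt -> nth 0 t' (size t) = v.
  by rewrite /t' => ->; rewrite nth_rcons ltnn eqxx.
have last_s' : bs -> nth 0 s' (size s) = v.
  by rewrite /s' => ->; rewrite nth_rcons ltnn eqxx.
have le_s' i : nth 0 s' i <= v.
  rewrite /s'; case: ltnP (mem_nth 0 (s := s) (n := i)) => [Hi /(_ isT)/sv /ltnW|Hi _].
    by case: (bs); rewrite // nth_rcons Hi.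
  case: (bs); last by rewrite nth_default.
  by rewrite nth_rcons ltnNge Hi /=; case: eqP.
clearbody s' t'; split=> [ok|[le_t ok] c /andP[le_rc]].
  split=> [|c Hc].
    rewrite leqNgt; apply/negP => lt_t.
    (* The last column of [t'] would have no entry above it. *)
    have /ok/andP[] : r <= (size t').-1 < size t' by lia.
    lia.
  have c_lt : c < size t by case/andP: Hc.
  have /ok/andP[lt_s' ] : r <= c < size t' by lia.
  rewrite nth_t' //; have [lt_s|ge_s] := ltnP (c - r) (size s).
    by rewrite nth_s'.
  (* The entry above column [c] would be [v] itself, larger than everything in [t]. *)
  have -> : c - r = size s by lia.
  rewrite last_s'; last by lia.
  have : nth 0 t c < v by exact/tv/mem_nth.
  by lia.
have [c_lt _|c_ge Hc] := ltnP c (size t).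
  have /ok/andP[lt_s le_st] : r <= c < size t by rewrite le_rc.
  by rewrite nth_s' // nth_t' // le_st andbT; lia.
have Ec : c = size t by lia.
by rewrite {3}Ec last_t' ?le_s' ?andbT; lia.
Qed.

(** Letters are added one at a time, and the length comparison of [columns_ok_rcons] is the test [V]
    on each prefix. The predicates [p1], [p2] allow either row to be the upper one. *)
Lemma ballot_columns (V : rel nat) (p1 p2 : pred letter) r w :
  (forall u, V (count_mem Up u) (count_mem Down u) = (count p2 u <= count p1 u + r)) ->
  ballot V w <-> columns_ok r (positions p1 w) (positions p2 w).
Proof.
move=> HV; elim: w => [|x w IHw]; first by split=> // _ c; rewrite /= andbF.
rewrite [positions p1 _]/= [positions p2 _]/= columns_ok_rcons.
- rewrite -IHw -![if _ then rcons _ _ else _]/(positions _ (x :: w)).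
  by rewrite !size_positions -HV; split=> [/andP[]|[? ?]] //; apply/andP.
- by move=> u /positions_bounds; lia.
by move=> u /positions_bounds; lia.
Qed.

Lemma count_has_up w : count has_up w = count_mem Up w + count_mem Both w.
Proof. by elim: w => //= -[[]|] w ->; rewrite /has_up /=; lia. Qed.

Lemma count_has_down w : count has_down w = count_mem Down w + count_mem Both w.
Proof. by elim: w => //= -[[]|] w ->; rewrite /has_down /=; lia. Qed.

Lemma ballot_encode r N s t : row_pair N s t ->
  ballot (fun h l => l <= h + r) (encode s t N) <-> columns_ok r s t.
Proof.
move=> /positions_encode[Es Et].
rewrite (ballot_columns (p1 := has_up) (p2 := has_down) (r := r)) ?Es ?Et //.
by move=> u; rewrite count_has_up count_has_down; lia.
Qed.

Lemma ballot_encode_rev r N s t : row_pair N s t ->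
  ballot (fun h l => h <= l + r) (encode s t N) <-> columns_ok r t s.
Proof.
move=> /positions_encode[Es Et].
rewrite (ballot_columns (p1 := has_down) (p2 := has_up) (r := r)) ?Es ?Et //.
by move=> u; rewrite count_has_up count_has_down; lia.
Qed.

Lemma size_content w :
  size w = count_mem Up w + count_mem Down w + count_mem Both w.
Proof. by elim: w => //= -[[]|] w ->; rewrite /= !add0n ?add1n ?addSn ?addnS. Qed.

(** Both row lengths and the total length give three linear equations that determine the three
    letter counts. *)
Lemma content_positions h l k w : size w = h + l + k ->
  (content w == (h, l, k)) =
  (size (positions has_up w) == h + k) && (size (positions has_down w) == l + k).
Proof.
rewrite size_content !size_positions count_has_up count_has_down /content.
rewrite !xpair_eqE; lia.
Qed.

Lemma rmaj_encode N s t : row_pair N s t ->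
  rmaj (encode s t N) = \sum_(0 <= i < N | (i \in s) && (i.+1 \in t)) i.
Proof.
case=> _ _ E.
(* Only the covering of 1..N is kept, since unlike [row_pair] it passes to smaller [N]. *)
have {E} : forall v, 0 < v <= N -> (v \in s) || (v \in t) by move=> v; rewrite E.
elim: N => [|N IHN] E; first by rewrite big_nil.
rewrite big_mkcond big_nat_recr //= -big_mkcond -IHN; last first.
  by move=> v Hv; apply: E; lia.
congr (_ + _).
have -> : top_weight (encode s t N) = if N \in s then N else 0.
  case: N {IHN} E => [|N] E; first by rewrite if_same.
  by rewrite /top_weight size_encode /=; case: (_ \in s); case: (_ \in t).
have := E N.+1; rewrite leqnn => /(_ isT).
by case: (N.+1 \in s); case: (N.+1 \in t) => //= _;
  rewrite ?andbT ?andbF; case: (N \in s).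
Qed.

(** * Two-row tableaux *)

Section TwoRowTableaux.

Variables n m r : nat.
Hypotheses (le_mn : m <= n) (le_rn : r <= n).

Local Notation la := [:: n; m].
Local Notation mu := [:: r].
Implicit Types (x y : box la mu) (T : filling la mu).

Lemma box_inj x y : row_of x = row_of y -> col_of x = col_of y -> x = y.
Proof.
case: x y => [[i c] Hx] [[i' c'] Hy] Ei Ec; apply/val_inj; congr (_, _).
  exact/val_inj.
exact/val_inj.
Qed.

Lemma boxP x :
  (row_of x = 0 /\ r <= col_of x < n) \/ (row_of x = 1 /\ col_of x < m).
Proof.
case: x => [[[[|[|i]] Hi] c] Hx] //; rewrite /row_of /col_of /=; first by left.
by right; split=> //; case/andP: Hx.
Qed.

Lemma box0_exists c : r <= c < n -> exists x, row_of x = 0 /\ col_of x = c.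
Proof.
move=> Hc; have c_lt : c < head 0 la by case/andP: Hc.
by exists (exist _ (@Ordinal (size la) 0 isT, Ordinal c_lt) Hc).
Qed.

Lemma box1_exists c : c < m -> exists x, row_of x = 1 /\ col_of x = c.
Proof.
move=> Hc; have c_lt : c < head 0 la by exact: leq_trans le_mn.
by exists (exist _ (@Ordinal (size la) 1 isT, Ordinal c_lt) Hc).
Qed.

Lemma card_box : #|box la mu| = n - r + m.
Proof.
rewrite card_sig -sum1_card.
rewrite (eq_bigl (fun p : 'I_2 * 'I_n => nth 0 mu p.1 <= p.2 < nth 0 la p.1)) //.
rewrite -(pair_big_dep xpredT
  (fun (i : 'I_2) (j : 'I_n) => nth 0 mu i <= j < nth 0 la i) (fun _ _ => 1)) /=.
have cnt a b : b <= n -> \sum_(j < n | a <= j < b) 1 = b - a.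
  move=> le_bn; rewrite -[RHS]muln1 -sum_nat_const_nat.
  rewrite (big_nat_widen _ _ _ _ _ le_bn) (big_nat_widenl _ 0) // big_mkord.
  by apply: eq_bigl => j; rewrite /= andbC.
have /= cnt0 := cnt 0 m le_mn.
by rewrite !big_ord_recl big_ord0 /= cnt // cnt0 subn0 addn0.
Qed.

Definition entry T (i c : nat) : nat :=
  if [pick x | (row_of x == i) && (col_of x == c)] is Some x then T x else 0.

Lemma entryE T x : entry T (row_of x) (col_of x) = T x.
Proof.
rewrite /entry; case: pickP => [y /andP[/eqP Er /eqP Ec]|/(_ x)].
  by rewrite (box_inj Er Ec).
by rewrite !eqxx.
Qed.

Definition top_row T := mkseq (fun j => entry T 0 (r + j)) (n - r).
Definition bottom_row T := mkseq (entry T 1) m.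

Lemma nth_top_row T x : row_of x = 0 -> nth 0 (top_row T) (col_of x - r) = T x.
Proof.
case: (boxP x) => [[Er Hc]|[-> //]] _.
by rewrite nth_mkseq ?subnKC -?Er ?entryE //; lia.
Qed.

Lemma nth_bottom_row T x : row_of x = 1 -> nth 0 (bottom_row T) (col_of x) = T x.
Proof.
case: (boxP x) => [[-> //]|[Er Hc]] _.
by rewrite nth_mkseq // -Er entryE.
Qed.

Lemma mem_top_row T v :
  (v \in top_row T) = [exists x, (row_of x == 0) && (T x == v :> nat)].
Proof.
apply/idP/existsP => [/mapP|[x /andP[/eqP Er /eqP <-]]].
  case=> j; rewrite mem_iota => Hj ->.
  have [|x [Er Ec]] := @box0_exists (r + j); first by lia.
  by exists x; rewrite -(entryE T x) Er Ec !eqxx.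
rewrite -(nth_top_row T Er) mem_nth // size_mkseq.
by case: (boxP x) => -[]; rewrite Er // => _; lia.
Qed.

Lemma mem_bottom_row T v :
  (v \in bottom_row T) = [exists x, (row_of x == 1) && (T x == v :> nat)].
Proof.
apply/idP/existsP => [/mapP|[x /andP[/eqP Er /eqP <-]]].
  case=> j; rewrite mem_iota => Hj ->; have [x [Er Ec]] := box1_exists Hj.
  by exists x; rewrite -(entryE T x) Er Ec !eqxx.
rewrite -(nth_bottom_row T Er) mem_nth // size_mkseq.
by case: (boxP x) => -[]; rewrite Er.
Qed.

Lemma rows_inj T T' :
  top_row T = top_row T' -> bottom_row T = bottom_row T' -> T = T'.
Proof.
move=> Et Eb; apply/ffunP => x; apply/val_inj.
case: (boxP x) => -[Er _].
  by rewrite /= -!nth_top_row // Et.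
by rewrite /= -!nth_bottom_row // Eb.
Qed.

Lemma row_increasing_rows T :
  row_increasing T = sorted ltn (top_row T) && sorted ltn (bottom_row T).
Proof.
have sortedE s : sorted ltn s <-> forall i j, i < j < size s -> nth 0 s i < nth 0 s j.
  split=> [ss i j /andP[lt_ij lt_j]|H]; last first.
    by apply/(sortedP 0) => i Hi; apply: H; rewrite ltnSn.
  by rewrite (sorted_ltn_nth ltn_trans 0 ss) // inE; apply: ltn_trans lt_j.
apply/idP/andP => [/forallP inc|[/sortedE inc0 /sortedE inc1]].
  split; apply/sortedE => i j; rewrite size_mkseq => /andP[lt_ij lt_j].
    have [|x [Ex Cx]] := @box0_exists (r + i); first by lia.
    have [|y [Ey Cy]] := @box0_exists (r + j); first by lia.
    have := forallP (inc x) y; rewrite Ex Ey Cx Cy ltn_add2l lt_ij /=.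
    by rewrite -nth_top_row // -nth_top_row // Cx Cy !addKn.
  have [|x [Ex Cx]] := @box1_exists i; first by lia.
  have [|y [Ey Cy]] := @box1_exists j; first by lia.
  have := forallP (inc x) y; rewrite Ex Ey Cx Cy lt_ij /=.
  by rewrite -nth_bottom_row // -nth_bottom_row // Cx Cy.
apply/forallP => x; apply/forallP => y; apply/implyP => /andP[/eqP Er lt_xy].
case: (boxP x) (boxP y) => -[Ex Cx] [] [Ey Cy]; rewrite ?Ex ?Ey in Er => //.
  rewrite -!nth_top_row //; apply: inc0; rewrite size_mkseq; lia.
rewrite -!nth_bottom_row //; apply: inc1; rewrite size_mkseq; lia.
Qed.

Lemma col_weakly_increasing_rows T :
  col_weakly_increasing T <-> columns_ok r (top_row T) (bottom_row T).
Proof.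
split=> [/forallP inc c|ok].
  rewrite !size_mkseq => Hc; have -> /= : c - r < n - r by lia.
  have [|x [Ex Cx]] := @box0_exists c; first by lia.
  have [|y [Ey Cy]] := @box1_exists c; first by lia.
  have := forallP (inc x) y; rewrite Ex Ey Cx Cy eqxx /=.
  by rewrite -nth_top_row // -nth_bottom_row // Cx Cy.
apply/forallP => x; apply/forallP => y; apply/implyP => /andP[/eqP Ec lt_xy].
case: (boxP x) (boxP y) => -[Ex Cx] [] [Ey Cy]; rewrite ?Ex ?Ey // in lt_xy.
have /ok/andP[_] : r <= col_of x < size (bottom_row T) by rewrite size_mkseq; lia.
by rewrite nth_top_row // Ec nth_bottom_row.
Qed.

Lemma mem_rows T v :
  (v \in top_row T) || (v \in bottom_row T) = [exists x, T x == v :> nat].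
Proof.
rewrite mem_top_row mem_bottom_row; apply/idP/existsP => [/orP[]/existsP|].
- by case=> x /andP[_ ?]; exists x.
- by case=> x /andP[_ ?]; exists x.
case=> x Tx; apply/orP; case: (boxP x) => -[Er _]; [left|right];
  by apply/existsP; exists x; rewrite Er Tx.
Qed.

(** The end of the initial segment is the maximal entry, hence equals [N]; this is [maxT], used in
    both directions. *)
Lemma RIncP k N T : N + k = n - r + m ->
  T \in RInc la mu k <->
  row_pair N (top_row T) (bottom_row T)
  /\ columns_ok r (top_row T) (bottom_row T).
Proof.
move=> EN; rewrite inE /is_row_increasing_tableau row_increasing_rows.
rewrite card_box -EN eqn_add2r.
have le_T x : T x <= n - r + m by rewrite -card_box -ltnS ltn_ord.
have maxT M : M <= n - r + m ->
    (forall v, [exists x, T x == v :> nat] = (0 < v <= M)) -> max_entry T = M.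
  move=> leM E; apply/eqP; rewrite eqn_leq; apply/andP; split.
    apply/bigmax_leqP => x _.
    have : [exists y, T y == T x :> nat] by apply/existsP; exists x.
    by rewrite E => /andP[].
  case: M {leM} E => // M /(_ M.+1); rewrite leqnn => /existsP[x /eqP <-].
  exact: leq_bigmax.
split=> [/andP[/and3P[/andP[s0 s1] ok init] /eqP maxN]|[[s0 s1 E] ok]].
  move/col_weakly_increasing_rows: ok => ok; split=> //; split=> // v; rewrite mem_rows.
  have [M HM] := existsP init.
  have E u : [exists x, T x == u :> nat] = (0 < u <= M).
    have leM : M <= n - r + m by rewrite -card_box -ltnS ltn_ord.
    (* The definition quantifies over bounded values only; larger ones are not entries at all. *)
    have [le_u|gt_u] := leqP u (n - r + m).
      have u_lt : u < #|box la mu|.+1 by rewrite card_box ltnS.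
      have := forallP HM (Ordinal u_lt) => /eqP <-.
      by apply/eq_existsb => x; rewrite -val_eqE.
    rewrite (_ : (u <= M) = false) ?andbF; last by lia.
    by apply/existsP => -[x /eqP Ex]; have := le_T x; lia.
  by rewrite E -maxN (maxT M) // -card_box -ltnS ltn_ord.
rewrite s0 s1 /=; have {}E v : [exists x, T x == v :> nat] = (0 < v <= N).
  by rewrite -mem_rows.
have leN : N <= n - r + m by lia.
rewrite (maxT N) // eqxx andbT; apply/andP; split.
  exact/col_weakly_increasing_rows.
have N_lt : N < #|box la mu|.+1 by rewrite card_box ltnS.
apply/existsP; exists (Ordinal N_lt); apply/forallP => v; rewrite -E.
by apply/eqP/eq_existsb => x; rewrite -val_eqE.
Qed.

Lemma rows_surj N s t : N <= n - r + m -> size s = n - r -> size t = m ->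
  row_pair N s t -> exists T, top_row T = s /\ bottom_row T = t.
Proof.
move=> leN sz_s sz_t [_ _ E].
have le_s i : i < n - r -> nth 0 s i <= #|box la mu|.
  rewrite -sz_s card_box => Hi; apply: leq_trans leN.
  by have := E (nth 0 s i); rewrite mem_nth //= => /esym/andP[].
have le_t i : i < m -> nth 0 t i <= #|box la mu|.
  rewrite card_box -{1}sz_t => Hi; apply: leq_trans leN.
  by have := E (nth 0 t i); rewrite mem_nth // orbT => /esym/andP[].
(* By [le_s] and [le_t] the entries lie within the bound, so [inord] preserves them. *)
pose T : filling la mu := [ffun x => inord
  (if row_of x == 0 then nth 0 s (col_of x - r) else nth 0 t (col_of x))].
exists T; split; apply: (@eq_from_nth _ 0); rewrite ?size_mkseq // => i Hi.
  have [|x [Ex Cx]] := @box0_exists (r + i); first by lia.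
  have := nth_top_row T Ex; rewrite Cx addKn => ->.
  by rewrite ffunE Ex Cx addKn inordK // ltnS le_s.
have [x [Ex Cx]] := box1_exists Hi.
have := nth_bottom_row T Ex; rewrite Cx => ->.
by rewrite ffunE Ex Cx inordK // ltnS le_t.
Qed.

Lemma is_descent_rows T i :
  is_descent T i = (i \in top_row T) && (i.+1 \in bottom_row T).
Proof.
rewrite mem_top_row mem_bottom_row.
apply/existsP/andP => [[x /existsP[y /and3P[Tx Ty]]]|].
  case: (boxP x) (boxP y) => -[Ex _] [] [Ey _]; rewrite Ex Ey // => _.
  by split; apply/existsP; [exists x; rewrite Ex Tx|exists y; rewrite Ey Ty].
case=> /existsP[x /andP[/eqP Ex Tx]] /existsP[y /andP[/eqP Ey Ty]].
by exists x; apply/existsP; exists y; rewrite Tx Ty Ex Ey.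
Qed.

Lemma is_ascent_rows T i :
  is_ascent T i = (i \in bottom_row T) && (i.+1 \in top_row T).
Proof.
rewrite mem_top_row mem_bottom_row.
apply/existsP/andP => [[x /existsP[y /and3P[Tx Ty]]]|].
  case: (boxP x) (boxP y) => -[Ex _] [] [Ey _]; rewrite Ex Ey // => _.
  by split; apply/existsP; [exists x; rewrite Ex Tx|exists y; rewrite Ey Ty].
case=> /existsP[x /andP[/eqP Ex Tx]] /existsP[y /andP[/eqP Ey Ty]].
by exists x; apply/existsP; exists y; rewrite Tx Ty Ex Ey.
Qed.

(** The sums in [maj] and [amaj] run up to the number of boxes, but no i >= N contributes, as i + 1
    is then not an entry. *)
Lemma sum_descents_encode N M s t : N <= M -> row_pair N s t ->
  \sum_(0 <= i < M | (i \in s) && (i.+1 \in t)) i = rmaj (encode s t N).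
Proof.
move=> leNM st; rewrite (rmaj_encode st) [RHS](big_nat_widen _ _ _ _ _ leNM).
apply: eq_bigl => i; case: ltnP => Hi; rewrite ?andbT ?andbF //.
apply/negP => /andP[_ it]; case: st => _ _ /(_ i.+1).
by rewrite it orbT => /esym/andP[_]; rewrite ltnNge Hi.
Qed.

End TwoRowTableaux.

(** Encoding is a bijection from [A] onto the ballot words of content (h, l, k). The rows [s] and
    [t] are abstract so that they may be taken in either order. *)
Lemma sum_encode_words (I : finType) (A : {set I}) (s t : I -> seq nat)
    (V : rel nat) (h l k N : nat) (R : comNzRingType) (q : R) :
  N = h + l + k ->
  (forall T, T \in A <-> row_pair N (s T) (t T) /\ ballot V (encode (s T) (t T) N)) ->
  (forall T, size (s T) = h + k) -> (forall T, size (t T) = l + k) ->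
  (forall T T', s T = s T' -> t T = t T' -> T = T') ->
  (forall s0 t0, size s0 = h + k -> size t0 = l + k -> row_pair N s0 t0 ->
     exists T, s T = s0 /\ t T = t0) ->
  (\sum_(T in A) q ^+ rmaj (encode (s T) (t T) N) =
   enum_words V (fun w => q ^+ rmaj w) N h l k)%R.
Proof.
move=> defN inA sz_s sz_t st_inj st_surj; pose enc T := encode (s T) (t T) N.
rewrite -big_enum -(big_map enc xpredT (fun w => q ^+ rmaj w)%R).
rewrite /enum_words -[RHS]big_filter.
apply: perm_big; apply: uniq_perm.
- rewrite map_inj_in_uniq ?enum_uniq // => T T'; rewrite !mem_enum.
  move=> /inA[/positions_encode[Es Et] _] /inA[/positions_encode[Es' Et'] _] E.
  have := congr1 (positions has_up) E; have := congr1 (positions has_down) E.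
  by rewrite Es Et Es' Et' => Et0 Es0; exact: st_inj.
- exact/filter_uniq/uniq_words.
move=> w; rewrite mem_filter mem_words; apply/mapP/andP.
  move=> [T]; rewrite mem_enum => /inA[rp V_w] ->; rewrite size_encode eqxx V_w.
  have [Es Et] := positions_encode rp.
  by rewrite content_positions ?size_encode // Es Et sz_s sz_t !eqxx.
case=> /andP[V_w cont_w] /eqP sz_w.
move: cont_w; rewrite content_positions ?sz_w // => /andP[/eqP su /eqP sd].
have rp := row_pair_positions w; rewrite sz_w in rp.
have [T [Es Et]] := st_surj _ _ su sd rp.
have Ew : enc T = w by rewrite /enc Es Et -sz_w encode_positions.
by exists T; rewrite // mem_enum; apply/inA; rewrite -/(enc T) Ew Es Et.
Qed.

(** * The two tableau sums as word enumerators *)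

Section TableauEnumeration.

Variables n m r k a b : nat.
Hypotheses (le_mn : m <= n) (le_rn : r <= n).
Hypotheses (def_a : n - r = a + k) (def_b : m = b + k).

Local Notation tableaux := (RInc [:: n; m] [:: r] k).

Variables (R : comNzRingType) (q : R).

Lemma sum_RInc_maj :
  (\sum_(T in tableaux) q ^+ maj T =
   enum_words (fun h l => l <= h + r)%N (fun w => q ^+ rmaj w) (a + b + k) a b k)%R.
Proof.
have EN : a + b + k + k = n - r + m by lia.
have inP T := RIncP le_mn le_rn T EN.
rewrite -(@sum_encode_words _ tableaux (@top_row n m r) (@bottom_row n m r)) //.
- apply: eq_bigr => T /inP[rp _]; congr (_ ^+ _)%R.
  rewrite -(sum_descents_encode (M := #|box [:: n; m] [:: r]|.+1) _ rp).
    by apply: eq_bigl => i; rewrite is_descent_rows.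
  by rewrite card_box //; lia.
- by move=> T; rewrite inP; split=> -[rp ok]; split=> //; apply/(ballot_encode r rp).
- by move=> T; rewrite size_mkseq.
- by move=> T; rewrite size_mkseq.
- exact: rows_inj.
by move=> s t sz_s sz_t; apply: rows_surj; lia.
Qed.

(** The bottom row now supplies the [Up] letters, which turns ascents into descents and swaps [a]
    with [b]. *)
Lemma sum_RInc_amaj :
  (\sum_(T in tableaux) q ^+ amaj T =
   enum_words (fun h l => h <= l + r)%N (fun w => q ^+ rmaj w) (b + a + k) b a k)%R.
Proof.
have EN : b + a + k + k = n - r + m by lia.
have inP T := RIncP le_mn le_rn T EN.
rewrite -(@sum_encode_words _ tableaux (@bottom_row n m r) (@top_row n m r)) //.
- apply: eq_bigr => T /inP[/row_pairC rp _]; congr (_ ^+ _)%R.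
  rewrite -(sum_descents_encode (M := #|box [:: n; m] [:: r]|.+1) _ rp).
    by apply: eq_bigl => i; rewrite is_ascent_rows.
  by rewrite card_box //; lia.
- move=> T; rewrite inP; split=> -[/row_pairC rp ok]; split=> //.
    exact/(ballot_encode_rev r rp).
  exact/(ballot_encode_rev r (row_pairC rp)).
- by move=> T; rewrite size_mkseq.
- by move=> T; rewrite size_mkseq.
- by move=> T T' Eb Et; exact: rows_inj.
move=> s t sz_s sz_t /row_pairC rp.
by have [|||T [Et Eb]] := rows_surj le_mn le_rn _ _ _ rp; [lia..|exists T].
Qed.

End TableauEnumeration.

(** In the word of [T], [a] and [b] count the letters [Up] and [Down]. Its length is the number of
    boxes minus [k], so exactly [k] letters are [Both]. *)
Lemma RInc_slack n m r k (T : filling [:: n; m] [:: r]) :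
  m <= n -> r <= n -> T \in RInc [:: n; m] [:: r] k ->
  exists a b, n - r = a + k /\ m = b + k.
Proof.
move=> le_mn le_rn T_in.
have /eqP EN : max_entry T + k == #|box [:: n; m] [:: r]|.
  by move: T_in; rewrite inE => /andP[].
rewrite card_box // in EN.
have [rp _] := (RIncP le_mn le_rn T EN).1 T_in.
have [Et Eb] := positions_encode rp.
set w := encode _ _ _ in Et Eb.
have := size_positions has_up w; rewrite Et size_mkseq count_has_up => Eu.
have := size_positions has_down w; rewrite Eb size_mkseq count_has_down => Ed.
have := size_content w; rewrite size_encode => Ew.
by exists (count_mem Up w), (count_mem Down w); lia.
Qed.

Lemma qvar_not_root a : (qvar ^+ a.+1 != 1)%R.
Proof.
rewrite /qvar -rmorphXn -(rmorph1 (@tofrac {poly rat})) /= tofrac_eq.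
by apply/eqP => /(congr1 (fun p : {poly rat} => size p));
  rewrite size_polyXn size_poly1.
Qed.

Theorem theorem1p2 (r n m k : nat)
  (r_gt0 : (0 < r)%N) (n_gt0 : (0 < n)%N) (m_gt0 : (0 < m)%N) (k_gt0 : (0 < k)%N)
  (le_mn : (m <= n)%N) (le_rn : (r <= n)%N)
  (RInc_neq0 : RInc [:: n; m] [:: r] k != set0) :
  ((\sum_(T in RInc [:: n; m] [:: r] k) qvar ^+ maj T =
      qvar ^+ ((k * (k - 1)) %/ 2)
      * qbinom qvar (n%:Z + m%:Z - r%:Z - k%:Z) k%:Z
      * (qbinom qvar (n%:Z + m%:Z - r%:Z - 2 * k%:Z) (n%:Z - r%:Z - k%:Z)
         - qbinom qvar (n%:Z + m%:Z - r%:Z - 2 * k%:Z) (n%:Z - k%:Z + 1)))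
  /\
   (\sum_(T in RInc [:: n; m] [:: r] k) qvar ^+ amaj T =
      qvar ^+ ((k * (k - 1)) %/ 2)
      * qbinom qvar (n%:Z + m%:Z - r%:Z - k%:Z) k%:Z
      * (qbinom qvar (n%:Z + m%:Z - r%:Z - 2 * k%:Z) (n%:Z - r%:Z - k%:Z)
         - qvar ^+ (r + 1)
           * qbinom qvar (n%:Z + m%:Z - r%:Z - 2 * k%:Z) (n%:Z - k%:Z + 1))))%R.
Proof.
have [T T_in] := set0Pn _ RInc_neq0.
have [a [b [def_a def_b]]] := RInc_slack le_mn le_rn T_in.
rewrite (sum_RInc_maj le_mn le_rn def_a def_b) (sum_RInc_amaj le_mn le_rn def_a def_b).
(* Both ballot side conditions read b <= a + r, which is m <= n. *)
rewrite enum_ballot_maj ?enum_ballot_amaj; [|lia..].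
have -> : (n%:Z + m%:Z - r%:Z - k%:Z = (a + b + k)%N%:Z)%R by lia.
have -> : (n%:Z + m%:Z - r%:Z - 2 * k%:Z = (a + b)%N%:Z)%R by lia.
have -> : (n%:Z - r%:Z - k%:Z = a%:Z)%R by lia.
have -> : (n%:Z - k%:Z + 1 = (a + r).+1%:Z)%R by lia.
rewrite !(qbinom_gauss qvar_not_root) bin2 subn1 divn2 addn1.
by rewrite (addnC b a).
Qed.
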